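(* Let $b(n,k)$ denote the Bessel numbers of the first kind and $B(n,k)$ the Bessel numbers of the second kind. Then for all nonnegative integers $n$ and $l$, $$\sum_{k=0}^{n} B(n,k)\,b(k,l) = \delta_{n,l}\qquad\text{and}\qquad \sum_{k=0}^{n} b(n,k)\,B(k,l) = \delta_{n,l},$$ where $\delta_{n,l}$ is the Kronecker delta.
   Context: For nonnegative integers $n,k$, let $[n]=\{1,\dots,n\}$ (with $[0]=\emptyset$). The Bessel number of the second kind $B(n,k)$ is the number of set partitions of $[n]$ into exactly $k$ nonempty blocks, each of size one or two; thus $B(n,k)=\dfrac{n!}{2^{n-k}(n-k)!(2k-n)!}$ if $\lceil n/2\rceil\le k\le n$, and $B(n,k)=0$ otherwise (in particular $B(0,0)=1$). The $n$th Bessel polynomial is $y_n(x)=\sum_{k=0}^{n}\dfrac{(n+k)!}{2^k\,k!\,(n-k)!}\,x^k$, the polynomial solution of $x^2y_n''+(2x+2)y_n'=n(n+1)y_n$ with $y_n(0)=1$. For $n\ge 1$ and $k\ge 0$, $a(n,k)$ is the coefficient of $x^{n-k}$ in $y_{n-1}(x)$ (taken to be $0$ if $k>n$), and the Bessel number of the first kind is $b(n,k)=(-1)^{n-k}a(n,k)$. Explicitly, for $n\ge1$: $b(n,k)=(-1)^{n-k}\dfrac{(2n-k-1)!}{2^{n-k}(n-k)!(k-1)!}$ if $1\le k\le n$, and $b(n,k)=0$ if $k=0$ or $k>n$. By convention $a(0,k)=b(0,k)=\delta_{0,k}$. *)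

(* Defs.v *)
From mathcomp Require Import all_boot all_order all_algebra.

Set Implicit Arguments.
Unset Strict Implicit.
Unset Printing Implicit Defensive.

Import GRing.Theory.
Local Open Scope ring_scope.

(* [n] = {1, ..., n} is represented by 'I_n = {0, ..., n - 1}.  A [partition]
   has no empty block, so "size at most 2" means size one or two. *)
Definition bessel2 (n k : nat) : nat :=
  #|[set P : {set {set 'I_n}} | [&& partition P [set: 'I_n], #|P| == k
      & [forall A in P, (#|A| <= 2)%N]]]|.

Definition bessel_poly (n : nat) : {poly rat} :=
  \sum_(0 <= k < n.+1)
    ((n + k)`!%N%:R / (2 ^ k * k`! * (n - k)`!)%N%:R) *: 'X^k.

Definition bessel_a (n k : nat) : rat :=
  match n with
  | 0 => (k == 0%N)%:R
  | m.+1 => if (k <= m.+1)%N then (bessel_poly m)`_(m.+1 - k) else 0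
  end.

(* For k > n the exponent is truncated to 0, but then bessel_a n k = 0. *)
Definition bessel1 (n k : nat) : rat := (-1) ^+ (n - k) * bessel_a n k.

(* Main.v *)
(* Conditioning on the block of a given point yields B(n+1,k+1) = B(n,k) + n B(n-1,k),
   whence B(n,k) = C(k, n-k) n! / (2^(n-k) k!) for k <= n.  For l >= 1, n = l + N
   with N >= 1 and k = l + j, the product B(n,k) b(k,l) is then a constant in j times
   (-1)^j C(N,j) C(2j+l-1, N-1), so the first sum is an N-th finite difference of
   a polynomial of degree N-1 and vanishes.  Hence the truncated triangular
   matrices satisfy B b = 1, and a one-sided inverse of a square matrix is
   two-sided. *)
Require Import Defs.
From mathcomp Require Import all_boot all_order all_algebra.
From mathcomp Require Import ring zify.

Set Implicit Arguments.
Unset Strict Implicit.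
Unset Printing Implicit Defensive.

Import GRing.Theory Num.Theory.
Local Open Scope ring_scope.

(** An arbitrary ground set [D] is allowed so that an induction can delete a block from it. *)
Definition pairings (T : finType) (D : {set T}) (k : nat) : {set {set {set T}}} :=
  [set P | [&& partition P D, #|P| == k & [forall A in P, (#|A| <= 2)%N]]].

Lemma partition_setD_notin (T : finType) (D B : {set T}) (Q : {set {set T}}) x :
  partition Q (D :\: B) -> x \in B -> B \notin Q.
Proof.
move=> partQ xB; apply/negP => BQ.
by have /subsetP/(_ x xB) := partitionS partQ BQ; rewrite inE xB.
Qed.

(** Deleting the block of [x] and putting it back are mutually inverse; [y = x] is allowed. *)
Lemma pairings_pblock (T : finType) (D : {set T}) (k : nat) (x y : T) :
  x \in D -> y \in D ->
  [set P in pairings D k.+1 | pblock P x == [set x; y]] =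
  [set [set x; y] |: Q | Q in pairings (D :\: [set x; y]) k].
Proof.
move=> xD yD; set B := [set x; y].
have xB : x \in B by rewrite !inE eqxx.
have B0 : B != set0 by apply/set0Pn; exists x.
have sBD : B \subset D by apply/subsetP=> z; rewrite !inE => /orP[]/eqP->.
have B2 : (#|B| <= 2)%N by rewrite cards2; case: eqP.
apply/setP => P; rewrite !inE; apply/idP/imsetP.
  case/andP=> /and3P[partP /eqP cardP /forall_inP sizeP] /eqP defB.
  have BP : B \in P by rewrite -defB pblock_mem // (cover_partition partP).
  exists (P :\ B); last by rewrite setD1K.
  rewrite inE partitionD1 //=; move: cardP; rewrite (cardsD1 B) BP add1n => -[->].
  by rewrite eqxx; apply/forall_inP => A; rewrite !inE => /andP[_]; apply: sizeP.
case=> Q; rewrite inE => /and3P[partQ /eqP cardQ /forall_inP sizeQ] ->.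
have BQ := partition_setD_notin partQ xB.
have partBQ : partition (B |: Q) D.
  rewrite -(setID D B) (setIidPr sBD).
  by apply: partitionU1 => //; rewrite -setI_eq0 setDE setICA setICr setI0.
rewrite partBQ cardsU1 BQ cardQ eqxx /= (@def_pblock _ _ B) ?eqxx ?andbT //.
- by apply/forall_inP=> A; rewrite in_setU1 => /predU1P[->|/sizeQ].
- exact: partition_trivIset partBQ.
- exact: setU11.
Qed.

Lemma card_le2_set2 (T : finType) (B : {set T}) x :
  x \in B -> (#|B| <= 2)%N -> exists2 y, y \in B & B = [set x; y].
Proof.
move=> xB; rewrite (cardsD1 x) xB ltnS => le1.
have [B0|/set0Pn[y yB]] := eqVneq (B :\ x) set0.
  by exists x => //; rewrite setUid -(setD1K xB) B0 setU0.
exists y; first by move: yB; rewrite inE => /andP[].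
rewrite -(setD1K xB); congr (_ |: _); apply/setP => z.
by rewrite inE; apply: (card_le1P le1).
Qed.

(* Classify the partitions by the block [{x, y}] of a fixed point [x]; the value
   [y = x] accounts for the case of a singleton block. *)
Lemma card_pairingsS (T : finType) (D : {set T}) (k : nat) (x : T) : x \in D ->
  #|pairings D k.+1| = (\sum_(y in D) #|pairings (D :\: [set x; y]) k|)%N.
Proof.
move=> xD; rewrite -sum1_card.
have injB : {in D &, injective (fun y => [set x; y])}.
  move=> y z _ _ /setP eqB; have := eqB y; have := eqB z; rewrite !inE !eqxx !orbT.
  by case: (eqVneq z x) => [->|_] /=; [case: (eqVneq y x)|move=> /eqP].
rewrite (partition_big (fun P => pblock P x)
  [in [set [set x; y] | y in D]]) /=; last first.
  move=> P; rewrite inE => /and3P[partP _ /forall_inP sizeP].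
  have xP : x \in cover P by rewrite (cover_partition partP).
  have BP := pblock_mem xP.
  have [||y yB ->] := @card_le2_set2 _ (pblock P x) x; rewrite ?mem_pblock ?sizeP //.
  by apply/imset_f/(subsetP (partitionS partP BP)).
rewrite big_imset //=; apply: eq_bigr => y yD.
(* Adjoining the block is injective: it is not in [Q], so deleting it recovers [Q]. *)
rewrite sum1dep_card -[RHS](card_in_imset (f := fun Q => [set x; y] |: Q)); last first.
  have xB : x \in [set x; y] by rewrite set21.
  move=> Q R; rewrite !inE => /and3P[partQ _ _] /and3P[partR _ _].
  move=> /(congr1 (fun P => P :\ [set x; y])).
  by rewrite !setU1K ?(partition_setD_notin partQ xB) ?(partition_setD_notin partR xB).
by rewrite -pairings_pblock //; apply: eq_card => P; rewrite !inE.
Qed.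

(** This is n! / (2^(n-k) (n-k)! (2k-n)!), written with a binomial that vanishes by itself when 2k <
    n. For [k > n] the truncated [n - k] would give n!/k!, hence the test. *)
Definition pair_count (n k : nat) : rat :=
  if (k <= n)%N then 'C(k, n - k)%:R * n`!%:R / (2 ^+ (n - k) * k`!%:R) else 0.

Lemma pair_countS n k :
  pair_count n.+1 k.+1 = pair_count n k + n%:R * pair_count n.-1 k.
Proof.
rewrite /pair_count ltnS; case: leqP => [kn|nk]; last first.
  by rewrite ifF ?mulr0 ?addr0 //; lia.
rewrite subSS; have [d ->] : exists d, n = (k + d)%N by exists (n - k)%N; lia.
have k0 m : m`!%:R != 0 :> rat by rewrite pnatr_eq0 -lt0n fact_gt0.
have k1 : k.+1%:R != 0 :> rat by rewrite pnatr_eq0.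
case: d => [|d].
  rewrite addn0 subnn expr0 !bin0 !mul1r !divff //.
  (* Here [n = k]: the last term vanishes through its factor [n] if [k = 0], and because [n.-1 < k]
     otherwise. *)
  by case: k {kn k1} => [|k]; rewrite ?mul0r ?addr0 //= ltnn mulr0 addr0.
(* The recurrence for n = k + d + 1, cleared of its common factors. *)
have /(congr1 (fun m => m%:R : rat)) : ('C(k.+1, d.+1) * (k + d.+1).+1 =
    k.+1 * ('C(k, d.+1) + 2 * 'C(k, d)))%N.
  (* Both terms on the right are multiples of ['C(k.+1, d.+1)], with factors k - d and 2(d + 1),
     which add up to k + d + 2. *)
  rewrite mulnDr mulnCA (mul_bin_diag k.+1 d) (mul_bin_down k.+1 d.+1) subSS.
  have [dk|kd] := leqP d k; last by rewrite bin_small // !muln0.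
  by rewrite mulnA -mulnDl mulnC; congr (_ * _)%N; lia.
rewrite addnS /= leq_addr -addnS !addKn addnS !factS !natrM natrD natrM exprS => key.
have p0 : (2 : rat) ^+ d != 0 by rewrite expf_neq0.
rewrite [LHS](_ : _ = 'C(k.+1, d.+1)%:R * (k + d).+2%:R *
  ((k + d).+1%:R * (k + d)`!%:R / (2 * 2 ^+ d * (k.+1%:R * k`!%:R)))); last first.
  by rewrite !mulrA.
rewrite key; move: (k0 k) k1 p0.
move: k`!%:R k.+1%:R (2 ^+ d) => x y z x0 y0 z0.
by field; rewrite x0 y0 z0.
Qed.

Lemma card_pairings (T : finType) (D : {set T}) (k : nat) :
  #|pairings D k|%:R = pair_count #|D| k.
Proof.
have [n] := ubnP #|D|; elim: n D k => // n IHn D k; rewrite ltnS => leDn.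
have [->|/set0Pn[x xD]] := eqVneq D set0.
  rewrite cards0 /pair_count leqn0; case: eqP => [->|/eqP k0].
    rewrite (_ : pairings _ _ = [set set0]) ?cards1 ?bin0 ?mulr1 ?mul1r ?invr1 //.
    apply/setP => P; rewrite !inE partition_set0 andbA.
    case: eqP => // -> /=; rewrite cards0 eqxx /=.
    by apply/forall_inP => A; rewrite inE.
  rewrite (_ : pairings _ _ = set0) ?cards0 //.
  apply/setP => P; rewrite !inE partition_set0; case: eqP => // ->.
  by rewrite cards0 eq_sym (negbTE k0).
have := cardsD1 x D; rewrite xD add1n => cardD.
case: k => [|k].
  rewrite cardD /pair_count /= bin0n mul0r mul0r (_ : pairings _ _ = set0) ?cards0 //.
  apply/setP => P; rewrite !inE cards_eq0; apply: contraTF isT => /and3P[partP /eqP P0 _].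
  by move: xD; rewrite -(cover_partition partP) P0 /cover big_set0 inE.
(* The term [y = x] leaves [#|D|] - 1 points; each of the [#|D|] - 1 others leaves [#|D|] - 2. This
   is the recurrence [pair_countS]. *)
rewrite (card_pairingsS k xD) natr_sum (big_setD1 x) //= setUid cardD pair_countS.
have ltDx : (#|D :\ x| < n)%N by rewrite -cardD.
rewrite (IHn _ _ ltDx); congr (_ + _).
rewrite (eq_bigr (fun=> pair_count #|D :\ x|.-1 k)) => [|y yDx].
  by rewrite sumr_const mulr_natl.
have := cardsD1 y (D :\ x); rewrite yDx add1n setDDl => cardDx.
by rewrite cardDx IHn // -cardDx ltnW.
Qed.

Lemma bessel2E n k : (bessel2 n k)%:R = pair_count n k.
Proof.
by rewrite -[LHS]/(#|pairings [set: 'I_n] k|%:R) card_pairings cardsT card_ord.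
Qed.

Lemma bessel1_n0 n : bessel1 n 0 = (n == 0)%:R.
Proof.
case: n => [|n]; rewrite /bessel1 /bessel_a /= ?mulr1 //.
rewrite /bessel_poly coef_sum big_mkord big1 ?mulr0 // => i _.
by rewrite coefZ coefXn subn0 gtn_eqF ?mulr0.
Qed.

Lemma bessel1_gt n k : (n < k)%N -> bessel1 n k = 0.
Proof.
case: n => [|n] nk; rewrite /bessel1 /bessel_a ?gtn_eqF ?mulr0 //.
by rewrite leqNgt nk mulr0.
Qed.

(** The shifted indices avoid truncated subtraction; only the monomial of degree [j] in
    [bessel_poly (l + j)] contributes. *)
Lemma bessel1E j l :
  bessel1 (l + j).+1 l.+1 =
  (-1) ^+ j * ((l + j + j)`!%:R / (2 ^+ j * j`!%:R * l`!%:R)).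
Proof.
rewrite /bessel1 /bessel_a ltnS leq_addr subSS addKn /bessel_poly coef_sum.
have jlj : (j < (l + j).+1)%N by lia.
rewrite big_mkord (bigD1 (Ordinal jlj)) //= coefZ coefXn eqxx mulr1 addnK.
rewrite big1 ?addr0 => [|i ij]; first by rewrite !natrM natrX.
rewrite coefZ coefXn; case: eqP => [ji|]; last by rewrite mulr0.
by case/eqP: ij; apply: val_inj.
Qed.

(* 'C(2 j + m, r) is a polynomial of degree r < N in j, so its N-th finite
   difference vanishes. *)
Lemma altsum_bin_bin0 (N m r : nat) : (r < N)%N ->
  \sum_(j < N.+1) (-1) ^+ j * 'C(N, j)%:R * 'C(j.*2 + m, r)%:R = 0 :> rat.
Proof.
elim: N m r => // N IHN m r rN.
(* By Pascal's rule, a difference of order N + 1 is a difference of order N of first differences. *)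
have recS (f : nat -> rat) : \sum_(j < N.+2) (-1) ^+ j * 'C(N.+1, j)%:R * f j =
    \sum_(j < N.+1) (-1) ^+ j * 'C(N, j)%:R * (f j - f j.+1).
  rewrite big_ord_recl expr0 bin0 !mul1r.
  under eq_bigr do rewrite lift0 binS natrD mulrDr mulrDl.
  rewrite big_split /= addrA.
  under [RHS]eq_bigr do rewrite mulrBr.
  rewrite sumrB; congr (_ + _).
    rewrite big_ord_recr /= bin_small // mulr0 mul0r addr0.
    by rewrite [RHS]big_ord_recl expr0 bin0 !mul1r.
  by rewrite -sumrN; apply: eq_bigr => j _; rewrite exprS !mulN1r !mulNr.
rewrite (recS (fun j => 'C(j.*2 + m, r)%:R)); case: r rN => [_|r rN].
  by rewrite big1 // => j _; rewrite !bin0 subrr mulr0.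
(* Two uses of Pascal's rule turn the first difference into two binomials of the same shape with
   lower index [r]. *)
rewrite (eq_bigr (fun j : 'I_N.+1 =>
  - ((-1) ^+ j * 'C(N, j)%:R * 'C(j.*2 + m.+1, r)%:R) -
  (-1) ^+ j * 'C(N, j)%:R * 'C(j.*2 + m, r)%:R)) => [|j _].
  by rewrite sumrB sumrN !IHN // oppr0 subr0.
by rewrite doubleS !addSn addnS !binS !natrD; ring.
Qed.

(** The factors (l+1+j)! cancel and the powers of 2 combine; regrouping the remaining factorials
    into two binomials leaves N!/(N+1)! = 1/(N+1). *)
Lemma pair_count_bessel1 (N l j : nat) : (j <= N.+1)%N ->
  pair_count (l.+1 + N.+1) (l.+1 + j) * bessel1 (l.+1 + j) l.+1 =
  (l.+1 + N.+1)`!%:R / (2 ^+ N.+1 * N.+1%:R * l`!%:R) *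
    ((-1) ^+ j * 'C(N.+1, j)%:R * 'C(j.*2 + l, N)%:R).
Proof.
move=> jN; rewrite {2}addSn bessel1E /pair_count leq_add2l jN subnDl.
have k0 m : m`!%:R != 0 :> rat by rewrite pnatr_eq0 -lt0n fact_gt0.
have -> : (l + j + j = j.*2 + l)%N by lia.
(* If 2j + l < N, the binomials on both sides vanish; otherwise all of them have factorial
   formulas. *)
have [small|big] := ltnP (j.*2 + l) N.
  have small' : (l.+1 + j < N.+1 - j)%N by lia.
  by rewrite (bin_small small) (bin_small small') !mul0r !mulr0.
have hC n m : (m <= n)%N -> 'C(n, m)%:R = n`!%:R / (m`!%:R * (n - m)`!%:R) :> rat.
  by move=> mn; rewrite -(bin_fact mn) !natrM mulfK ?mulf_neq0.
rewrite !hC //; try lia.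
have -> : (l.+1 + j - (N.+1 - j) = j.*2 + l - N)%N by lia.
have -> : (2 : rat) ^+ N.+1 = 2 ^+ (N.+1 - j) * 2 ^+ j by rewrite -exprD subnK.
have p0 m : (2 : rat) ^+ m != 0 by rewrite expf_neq0.
have n0 : N.+1%:R != 0 :> rat by rewrite pnatr_eq0.
rewrite [N.+1`!]factS natrM.
have := (k0 (l.+1 + j)%N, k0 (N.+1 - j)%N, k0 (j.*2 + l - N)%N).
move: (k0 j) (k0 l) (k0 N) (p0 j) (p0 (N.+1 - j)%N) n0.
move: (2 ^+ (N.+1 - j)) (2 ^+ j) j`!%:R l`!%:R N`!%:R N.+1%:R.
move: (l.+1 + j)`!%:R (N.+1 - j)`!%:R (j.*2 + l - N)`!%:R.
move=> x y z u v w t p q u0 v0 w0 q0 p0' t0 [[x0 y0] z0].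
by field; rewrite x0 y0 z0 u0 v0 w0 t0 q0 p0'.
Qed.

Lemma sum_bessel2_bessel1 n l :
  \sum_(0 <= k < n.+1) (bessel2 n k)%:R * bessel1 k l = (n == l)%:R.
Proof.
under eq_bigr do rewrite bessel2E.
(* Column 0 is separate because the product formula needs a positive column index. *)
case: l => [|l].
  under eq_bigr do rewrite bessel1_n0.
  rewrite big_nat_recl //= mulr1 big1 => [|i _]; last by rewrite mulr0.
  by rewrite addr0 /pair_count /= subn0; case: n => [|n]; rewrite ?bin0n ?mul0r.
have [nl|ln] := ltnP n l.+1.
  rewrite ltn_eqF // big_nat big1 // => k /andP[_ kn].
  by rewrite bessel1_gt ?mulr0 //; lia.
have [N ->] : exists N, n = (l.+1 + N)%N by exists (n - l.+1)%N; lia.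
(* The terms with [k < l.+1] vanish; the others are reindexed by k = l + 1 + j. *)
rewrite (big_cat_nat (n := l.+1)) //=; last by lia.
rewrite big_nat big1 ?add0r => [|k /andP[_ kn]]; last first.
  by rewrite bessel1_gt ?mulr0.
rewrite -{1}(add0n l.+1) big_addn -addnS addKn big_mkord.
case: N => [|N].
  rewrite big_ord1 add0n addn0 eqxx.
  have := bessel1E 0 l; rewrite !addn0 => ->.
  have k0 m : m`!%:R != 0 :> rat by rewrite pnatr_eq0 -lt0n fact_gt0.
  by rewrite /pair_count leqnn subnn bin0 !mul1r !divff.
rewrite gtn_eqF; last by lia.
under eq_bigr => j _ do
  rewrite [(j + l.+1)%N]addnC (pair_count_bessel1 _ (ltn_ord j : j <= N.+1)%N).
by rewrite -mulr_sumr altsum_bin_bin0 ?mulr0.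
Qed.

Lemma bessel2_gt n k : (n < k)%N -> (bessel2 n k)%:R = 0 :> rat.
Proof. by move=> nk; rewrite bessel2E /pair_count leqNgt nk. Qed.

Theorem theorem2p3 (n l : nat) :
  \sum_(0 <= k < n.+1) (bessel2 n k)%:R * bessel1 k l = (n == l)%:R /\
  \sum_(0 <= k < n.+1) bessel1 n k * (bessel2 k l)%:R = (n == l)%:R.
Proof.
split; first exact: sum_bessel2_bessel1.
(* Large enough for both [n] and [l] to index the truncated matrices. *)
pose M := maxn n l.
pose B : 'M[rat]_M.+1 := \matrix_(i, j) (bessel2 i j)%:R.
pose b : 'M[rat]_M.+1 := \matrix_(i, j) bessel1 i j.
(* By triangularity, the sums in row [i] of the matrix products stop at [k = i]. *)
have extend (f : nat -> rat) (i : 'I_M.+1) : (forall k, (i < k)%N -> f k = 0) ->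
    \sum_(k < M.+1) f k = \sum_(0 <= k < i.+1) f k.
  move=> f0; rewrite -(big_mkord xpredT) (big_cat_nat (n := i.+1)) //=.
  by rewrite [X in _ + X]big_nat [X in _ + X]big1 ?addr0 // => k /andP[/f0].
have /mulmx1C/matrixP bB1 : B *m b = 1%:M.
  apply/matrixP => i j; rewrite !mxE; under eq_bigr do rewrite !mxE.
  rewrite (extend (fun k => (bessel2 i k)%:R * bessel1 k j) i) => [|k ik].
    by rewrite sum_bessel2_bessel1.
  by rewrite bessel2_gt ?mul0r.
have nM : (n < M.+1)%N by rewrite ltnS leq_maxl.
have lM : (l < M.+1)%N by rewrite ltnS leq_maxr.
have := bB1 (Ordinal nM) (Ordinal lM); rewrite !mxE.
under eq_bigr do rewrite !mxE.
rewrite (extend (fun k => bessel1 n k * (bessel2 k l)%:R) (Ordinal nM)) // => k nk.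
by rewrite bessel1_gt ?mul0r.
Qed.
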